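(* Consider $K$ agents running the diffusion HMM strategy (DHS) with parameter $\gamma>0$, under the setting and assumptions described in the context. Then for each agent $k$, the risks $J_{k,i}$ and $\widetilde{J}_{k,i}$ satisfy \[ \limsup_{i\to\infty} J_{k,i} \le \frac{2\sqrt{K}\,\gamma\,\lambda\, C_L}{1-\kappa(\mathbb{T})} \qquad\text{and}\qquad \limsup_{i\to\infty} \widetilde{J}_{k,i} \le \frac{2\kappa(\mathbb{T})\sqrt{K}\,\gamma\,\lambda\, C_L}{1-\kappa(\mathbb{T})}, \] where $\lambda \triangleq \max\{|1-K/\gamma|,\rho_2\}$ and $\rho_2$ is the second largest modulus eigenvalue of the combination matrix $A$.
   Context: Hypotheses and model. A finite set $\Theta=\{0,1,\dots,H-1\}$ of hypotheses. The true state $\bm\theta_i^\circ\in\Theta$, $i\ge 0$, is a Markov chain with known transition kernel $\mathbb{T}(\theta_i|\theta_{i-1})=\mathbb{P}(\bm\theta_i^\circ=\theta_i\mid\bm\theta_{i-1}^\circ=\theta_{i-1})$ and initial distribution $\mu_0^\star$. At each time $i\ge1$, each agent $k\in\{1,\dots,K\}$ observes $\bm\xi_{k,i}$ with known likelihood $L_k(\cdot|\bm\theta_i^\circ)$ (a density); conditioned on the state sequence, observations are independent across agents and time, so the joint likelihood of $\bm\xi_i=\{\bm\xi_{k,i}\}_{k=1}^K$ is $L(\bm\xi_i|\theta)=\prod_{k=1}^K L_k(\bm\xi_{k,i}|\theta)$. For all $k,\theta,\theta'$, $D_{\mathrm{KL}}(L_k(\cdot|\theta)\|L_k(\cdot|\theta'))<\infty$.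 Regularity: there is $C_L$ with $|\log L_k(\xi|\theta)|\le C_L$ for all $k$, $\theta$ and all $\xi$ in the support. Network. A strongly connected graph with at least one self-loop; combination matrix $A=[a_{\ell k}]$ with $a_{\ell k}>0$ iff $\ell\in\mathcal N_k$ (neighborhood of $k$), $A$ doubly stochastic and symmetric ($A\mathbf 1=\mathbf 1$, $A=A^{\mathsf T}$), hence primitive. Centralized filter. With $\boldsymbol{\mathcal F}_i=\{\bm\xi_j\}_{j=1}^i$: $\bm\mu_i^\star(\theta)=\mathbb{P}(\bm\theta_i^\circ=\theta|\boldsymbol{\mathcal F}_i)$, satisfying $\bm\eta_i^\star(\theta)=\sum_{\theta'}\mathbb{T}(\theta|\theta')\bm\mu_{i-1}^\star(\theta')$ and $\bm\mu_i^\star(\theta)\propto L(\bm\xi_i|\theta)\bm\eta_i^\star(\theta)$. DHS. Initial beliefs $\mu_{k,0}(\theta)>0$ for all $k,\theta$ (and $\mu_0^\star(\theta)>0$). For $i\ge1$: (evolve) $\bm\eta_{k,i}(\theta)=\sum_{\theta'}\mathbb{T}(\theta|\theta')\bm\mu_{k,i-1}(\theta')$; (adapt) $\bm\psi_{k,i}(\theta)\propto (L_k(\bm\xi_{k,i}|\theta))^{\gamma}\bm\eta_{k,i}(\theta)$; (combine) $\bm\mu_{k,i}(\theta)\propto\prod_{\ell\in\mathcal N_k}(\bm\psi_{\ell,i}(\theta))^{a_{\ell k}}$, where $\propto$ means normalization over $\theta\in\Theta$. Risks. $J_{k,i}=\mathbb{E}_{\mathcal F_i} D_{\mathrm{KL}}(\bm\mu_i^\star\|\bm\mu_{k,i})$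 and $\widetilde J_{k,i}=\mathbb{E}_{\mathcal F_{i-1}}D_{\mathrm{KL}}(\bm\eta_i^\star\|\bm\eta_{k,i})$, expectations over the observations. Transition model. Dobrushin coefficient $\kappa(\mathbb{T})=\sup_{\theta',\theta''}\frac12\sum_{\theta}|\mathbb{T}(\theta|\theta')-\mathbb{T}(\theta|\theta'')|\in[0,1]$; it is assumed that $\kappa(\mathbb{T})<1$ (geometric ergodicity), and the chain is irreducible and aperiodic. *)

(* Defs.v *)
From HB Require Import structures.
From mathcomp Require Import all_boot all_order all_algebra.
From mathcomp Require Import all_classical all_reals all_analysis.
Set Implicit Arguments. Unset Strict Implicit. Unset Printing Implicit Defensive.
Import Order.TTheory GRing.Theory Num.Theory.
Import numFieldNormedType.Exports.
Local Open Scope ring_scope.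

Section DHS.
Context {R : realType} {d : measure_display} {X : measurableType d}.
Context {H K : nat}.

(* A (joint) observation at one time instant: one observation per agent. *)
Definition jobs := 'I_K -> X.

Definition normalize (f : 'I_H -> R) : 'I_H -> R :=
  fun th => f th / \sum_(t < H) f t.

(* T th th' = T(th | th') *)
Definition predict (T : 'I_H -> 'I_H -> R) (mu : 'I_H -> R) : 'I_H -> R :=
  fun th => \sum_(th' < H) T th th' * mu th'.

(* joint likelihood L(xi | th) = prod_k L_k(xi_k | th);  L k th x = L_k(x | th) *)
Definition Ljoint (L : 'I_K -> 'I_H -> X -> R) (xi : jobs) (th : 'I_H) : R :=
  \prod_(k < K) L k th (xi k).

(* centralized (optimal) filter mu_i^* after the observation history s
   (chronological: s = [:: xi_1; ...; xi_i]) *)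
Definition cstep T L (mu : 'I_H -> R) (xi : jobs) : 'I_H -> R :=
  normalize (fun th => Ljoint L xi th * predict T mu th).
Definition mu_star T L (mu0 : 'I_H -> R) (s : seq jobs) : 'I_H -> R :=
  foldl (cstep T L) mu0 s.

Definition dstep T L (A : 'M[R]_K) (gamma : R)
    (mu : 'I_K -> 'I_H -> R) (xi : jobs) : 'I_K -> 'I_H -> R :=
  let eta := fun k => predict T (mu k) in
  let psi := fun l => normalize (fun th => (L l th (xi l)) `^ gamma * eta l th) in
  fun k => normalize (fun th => \prod_(l < K | 0 < A l k) (psi l th) `^ (A l k)).
Definition dhs T L A gamma (mu0 : 'I_K -> 'I_H -> R) (s : seq jobs)
  : 'I_K -> 'I_H -> R := foldl (dstep T L A gamma) mu0 s.

Definition KLd (p q : 'I_H -> R) : R :=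
  \sum_(th < H) p th * ln (p th / q th).

(* joint density of the observation history s (w.r.t. the product of the
   reference measures): unnormalized forward recursion of the HMM *)
Definition fwd T L (alpha : 'I_H -> R) (xi : jobs) : 'I_H -> R :=
  fun th => Ljoint L xi th * predict T alpha th.
Definition obs_density T L (mu0 : 'I_H -> R) (s : seq jobs) : R :=
  \sum_(th < H) foldl (fwd T L) mu0 s th.

Fixpoint iter_int (ms : seq {measure set X -> \bar R}) (h : seq X -> \bar R)
  : \bar R :=
  match ms with
  | [::] => h [::]
  | m :: ms' => (\int[m]_x iter_int ms' (fun b => h (x :: b)))%E
  end.

Definition jobs_of (b : seq X) : jobs := fun k => nth point b k.

(* integral over i joint observations w.r.t. the product reference measure *)
Fixpoint nest_int (nu : 'I_K -> {measure set X -> \bar R}) (i : nat)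
    (h : seq jobs -> \bar R) : \bar R :=
  match i with
  | 0 => h [::]
  | n.+1 => iter_int [seq nu k | k <- enum 'I_K]
              (fun b => nest_int nu n (fun s => h (jobs_of b :: s)))
  end.

Definition Eobs nu T L mu0 (i : nat) (g : seq jobs -> R) : \bar R :=
  nest_int nu i (fun s => (obs_density T L mu0 s * g s)%:E).

Definition risk_J nu T L A gamma mu0s (mu0 : 'I_H -> R) (k : 'I_K) (i : nat)
  : \bar R :=
  Eobs nu T L mu0 i
    (fun s => KLd (mu_star T L mu0 s) (dhs T L A gamma mu0s s k)).
Definition risk_Jt nu T L A gamma mu0s (mu0 : 'I_H -> R) (k : 'I_K) (i : nat)
  : \bar R :=
  Eobs nu T L mu0 i.-1
    (fun s => KLd (predict T (mu_star T L mu0 s))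
                  (predict T (dhs T L A gamma mu0s s k))).

Definition KL_lik (nu : 'I_K -> {measure set X -> \bar R}) L k (th th' : 'I_H)
  : \bar R :=
  (\int[nu k]_x (L k th x * ln (L k th x / L k th' x))%:E)%E.

Definition dobrushin (T : 'I_H -> 'I_H -> R) : R :=
  \big[Num.max/0]_(t1 < H) \big[Num.max/0]_(t2 < H)
     (2^-1 * \sum_(th < H) `|T th t1 - T th t2|).

Fixpoint Tn (T : 'I_H -> 'I_H -> R) (n : nat) : 'I_H -> 'I_H -> R :=
  match n with
  | 0 => fun th th' => (th == th')%:R
  | m.+1 => fun th th' => \sum_(t < H) T th t * Tn T m t th'
  end.

Definition irreducible_chain (T : 'I_H -> 'I_H -> R) : Prop :=
  forall th th' : 'I_H, exists2 n, (0 < n)%N & 0 < Tn T n th th'.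

Definition aperiodic_chain (T : 'I_H -> 'I_H -> R) : Prop :=
  forall (th : 'I_H) (p : nat),
    (forall n, (0 < n)%N -> 0 < Tn T n th th -> (p %| n)%N) -> p = 1%N.

Definition strongly_connected (A : 'M[R]_K) : Prop :=
  forall l k : 'I_K, connect (fun a b => 0 < A a b) l k.

(* rho2 is the second largest modulus among the eigenvalues of A counted with
   multiplicity (spectrum s, sorted by nonincreasing modulus; for K = 1 this
   gives rho2 = 0) *)
Definition second_modulus_eigenvalue (A : 'M[R]_K) (rho2 : R) : Prop :=
  exists s : seq R,
    [/\ char_poly A = \prod_(x <- s) ('X - x%:P),
        sorted (fun x y => `|y| <= `|x|) s
      & rho2 = `|s`_1|].

End DHS.

(* Main.v *)
Require Import Defs.
From HB Require Import structures.
From mathcomp Require Import all_boot all_order all_algebra.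
From mathcomp Require Import all_classical all_reals all_analysis.
From mathcomp Require Import complex spectral ring lra.
Set Implicit Arguments. Unset Strict Implicit. Unset Printing Implicit Defensive.
Import Order.TTheory GRing.Theory Num.Theory.
Import numFieldNormedType.Exports.
Local Open Scope ring_scope.

(* Write [J_k], [Jt_k] for the two risks, and [B] for
   [sqrt K * gamma * lambda * C_L].

   Bayes' rule and the log-linear pooling write [ln (mu* / mu_k)] as
   [sum_l a_lk ln (eta* / eta_l)], plus a weighted log-likelihood defect
   [sum_l (1 - gamma a_lk) ln L_l], bounded by [B], plus a ratio of normalizing
   constants.  Up to a factor [exp B], the latter is at most
   [sum_th L (sum_l a_lk eta_l) / sum_th L eta*] by the AM-GM inequality; after
   [ln x <= x - 1] and integration against the density of the new observation
   it contributes nothing.  Hence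
   [J_k(i) <= sum_l a_lk Jt_l(i) + 2 B], while the strong data-processing
   inequality gives [Jt_k(i) <= kappa J_k(i-1)].

   The bound on the defect is Cauchy-Schwarz together with
   [sum_l (a_lk - 1/gamma)^2 = (1 - K/gamma)^2 / K + sum_l (a_lk - 1/K)^2] and
   the spectral theorem for [A] on the orthogonal complement of the constants. *)

(** * The spectral bound on the columns of A *)

Lemma char_poly_invmx_conj (F : fieldType) n (P D : 'M[F]_n) :
  P \in unitmx -> char_poly (invmx P *m D *m P) = char_poly D.
Proof.
move=> Pu; rewrite /char_poly /char_poly_mx.
have -> : 'X%:M - map_mx polyC (invmx P *m D *m P) =
    map_mx polyC (invmx P) *m ('X%:M - map_mx polyC D) *m map_mx polyC P.
  rewrite mulmxBr mulmxBl !map_mxM; congr (_ - _).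
  by rewrite mul_mx_scalar -scalemxAl -map_mxM mulVmx// map_mx1 scalemx1.
rewrite !det_mulmx mulrAC -det_mulmx -map_mxM mulVmx// map_mx1 det1 mul1r//.
Qed.

(** Similar matrices share their characteristic polynomial, whose linear factors are unique up to
    order; this keeps multiplicities. *)
Lemma perm_spectral_diag (C : numClosedFieldType) n (A : 'M[C]_n) (s : seq C) :
  A \is normalmx -> char_poly A = \prod_(x <- s) ('X - x%:P) ->
  perm_eq [seq spectral_diag A 0 i | i : 'I_n] s.
Proof.
move=> /orthomx_spectralP An As; apply: prod_XsubC_eq.
rewrite -As {2}An char_poly_invmx_conj ?spectral_unit//.
rewrite char_poly_trig ?diag_mx_trig// big_map big_enum/=.
by apply: eq_bigr => i _; rewrite mxE eqxx mulr1n.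
Qed.

Lemma dotC_unitary (C : numClosedFieldType) n (P : 'M[C]_n) (x y : 'rV[C]_n) :
  P \is unitarymx ->
  (x *m P) *m (map_mx Num.conj (y *m P)^T) = x *m map_mx Num.conj y^T.
Proof.
move=> Pu; rewrite trmx_mul map_mxM !mulmxA; congr (_ *m _).
exact: mulmxtVK.
Qed.

(** In an orthonormal eigenbasis the fixed vector [v] has a nonzero coordinate with eigenvalue 1.
    The entries of [s] have modulus below 1, so this eigenvalue is [s0] and is simple: [v] spans one
    axis, [w] has no component on it, and the other components are scaled by at most [rho]. *)
Lemma normal_orth_contract (C : numClosedFieldType) n (A : 'M[C]_n)
    (s : seq C) (s0 rho : C) (v w : 'rV[C]_n) :
  A \is normalmx -> char_poly A = \prod_(x <- s0 :: s) ('X - x%:P) ->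
  {in s, forall x, `|x| <= rho} -> 0 <= rho -> rho < 1 ->
  v *m A = v -> v != 0 -> w *m map_mx Num.conj v^T = 0 ->
  \sum_i `|(w *m A) 0 i| ^+ 2 <= rho ^+ 2 * \sum_i `|w 0 i| ^+ 2.
Proof.
move=> An As sle rho0 rho1 vA v0 wv.
have dot (u : 'rV[C]_n) : \sum_i `|u 0 i| ^+ 2 = (u *m map_mx Num.conj u^T) 0 0.
  by rewrite mxE; apply: eq_bigr => i _; rewrite !mxE normCK.
have := perm_spectral_diag An As.
set P := spectralmx A; set D := spectral_diag A => permD.
have Pu : P \is unitarymx by exact: spectral_unitarymx.
have PU : P \in unitmx by exact: spectral_unit.
have AE : A = invmx P *m diag_mx D *m P by exact/orthomx_spectralP.
have [x wE] : exists x, w = x *m P by exists (w *m invmx P); rewrite mulmxKV.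
have [y vE] : exists y, v = y *m P by exists (v *m invmx P); rewrite mulmxKV.
have xA u : u *m P *m A = u *m diag_mx D *m P.
  by rewrite AE !mulmxA mulmxK.
have yD : y *m diag_mx D = y.
  by rewrite -[LHS](mulmxK PU) -xA -vE vA vE mulmxK.
have wA : w *m A = x *m diag_mx D *m P by rewrite wE xA.
have yi i : y 0 i * (D 0 i - 1) = 0.
  have /matrixP/(_ 0 i) := yD; rewrite mul_mx_diag mxE => e.
  by rewrite mulrBr e mulr1 subrr.
have /existsP[i0 yi0] : [exists i, y 0 i != 0].
  apply: contraNT v0; rewrite negb_exists => /forallP yN.
  rewrite vE (_ : y = 0) ?mul0mx//; apply/rowP => i; rewrite mxE.
  by have := yN i; rewrite negbK => /eqP.
have Di0 : D 0 i0 = 1.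
  by have /eqP := yi i0; rewrite mulf_eq0 (negPf yi0)/= subr_eq0 => /eqP.
have s0E : s0 = 1.
  have : 1 \in s0 :: s.
    by rewrite -(perm_mem permD); apply/mapP; exists i0; rewrite ?mem_enum.
  rewrite inE => /orP[/eqP//|/sle]; rewrite normr1 => /le_lt_trans/(_ rho1).
  by rewrite ltxx.
(* Deleting the index [i0] cancels one occurrence of [s0], so the remaining diagonal entries are a
   permutation of [s]. *)
have Dle i : i != i0 -> `|D 0 i| <= rho.
  move=> ii0; apply: sle.
  have : perm_eq [seq D 0 i | i <- rem i0 (enum 'I_n)] s.
    rewrite -(perm_cons s0) s0E -{1}Di0 -[_ :: _]/(map _ (i0 :: _)).
    rewrite perm_sym -{1}s0E; apply: perm_trans (_ : perm_eq _ [seq D 0 i | i : 'I_n]) _.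
      by rewrite perm_sym.
    by apply: perm_map; apply: perm_to_rem; rewrite mem_enum.
  move=> /perm_mem <-; apply/mapP; exists i => //.
  by rewrite mem_rem_uniq ?enum_uniq// !inE ii0 mem_enum.
have yN i : i != i0 -> y 0 i = 0.
  move=> /Dle Di; have /eqP := yi i; rewrite mulf_eq0 => /orP[/eqP//|].
  rewrite subr_eq0 => /eqP D1; move: Di; rewrite D1 normr1.
  by move=> /le_lt_trans/(_ rho1); rewrite ltxx.
have xi0 : x 0 i0 = 0.
  move: wv; rewrite wE vE dotC_unitary// => /matrixP/(_ 0 0).
  rewrite mxE (bigD1 i0)//= big1 ?addr0 => [|i /yN yi0']; last first.
    by rewrite !mxE yi0' rmorph0 mulr0.
  rewrite !mxE => /eqP; rewrite mulf_eq0 conjC_eq0 (negPf yi0) orbF => /eqP.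
  by [].
rewrite !dot wA wE !(dotC_unitary _ _ Pu) -(dot x) -(dot (x *m diag_mx D)) mulr_sumr; apply: ler_sum => i _.
have [->|ii0] := eqVneq i i0.
  by rewrite mul_mx_diag mxE xi0 mul0r normr0 expr0n/= mulr0.
rewrite mul_mx_diag mxE normrM exprMn mulrC ler_wpM2r ?exprn_ge0//.
by rewrite lerXn2r ?nnegrE// Dle.
Qed.

Lemma sum_sqr_sub (R : comPzRingType) K (a : 'I_K -> R) (c : R) :
  \sum_l (a l - c) ^+ 2 =
    \sum_l a l ^+ 2 - c *+ 2 * \sum_l a l + K%:R * c ^+ 2.
Proof.
under eq_bigr => l _ do rewrite sqrrB.
rewrite big_split sumrB/= sumr_const card_ord mulr_natl mulr_sumr.
by congr (_ - _ + _); apply: eq_bigr => l _; ring.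
Qed.

Lemma sum_sqr_dev (R : realFieldType) K (a : 'I_K -> R) :
  (0 < K)%N -> \sum_l a l = 1 ->
  \sum_l (a l - K%:R^-1) ^+ 2 = \sum_l a l ^+ 2 - K%:R^-1.
Proof.
move=> K0 a1; rewrite sum_sqr_sub a1; field.
by rewrite pnatr_eq0 -lt0n.
Qed.

(** Cauchy-Schwarz against the constant vector, from the squared deviations of the [|a l|] from
    their mean. *)
Lemma sqr_sum_norm_le (R : realFieldType) K (a : 'I_K -> R) :
  (\sum_l `|a l|) ^+ 2 <= K%:R * \sum_l a l ^+ 2.
Proof.
have [K0|K0] := posnP K.
  by move: (a); rewrite K0 => b; rewrite !big_ord0 expr0n mul0r.
have K1 : 0 < K%:R :> R by rewrite ltr0n.
have : 0 <= \sum_l (`|a l| - K%:R^-1 * \sum_j `|a j|) ^+ 2.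
  by apply: sumr_ge0 => l _; exact: sqr_ge0.
rewrite sum_sqr_sub.
under [X in _ <= X - _ + _]eq_bigr do rewrite real_normK ?num_real//.
set S := \sum_l `|a l|; set Q := \sum_l _.
have -> : Q - (K%:R^-1 * S) *+ 2 * S + K%:R * (K%:R^-1 * S) ^+ 2
   = K%:R^-1 * (K%:R * Q - S ^+ 2) by field; rewrite gt_eqF.
by rewrite pmulr_rge0 ?invr_gt0// subr_ge0.
Qed.

(* The second modulus only matters when it is below [1]; otherwise row sums
   already bound the squared norm of a column of [A] by [1]. *)
Lemma sum_sqr_dev_col_le (R : rcfType) K (A : 'M[R]_K) (s : seq R) k :
  (forall l k, 0 <= A l k) -> (forall k, \sum_l A k l = 1) -> A = A^T ->
  char_poly A = \prod_(x <- s) ('X - x%:P) ->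
  sorted (fun x y => `|y| <= `|x|) s ->
  \sum_l (A l k - K%:R^-1) ^+ 2 <= `|s`_1| ^+ 2 * (1 - K%:R^-1).
Proof.
move=> A_ge0 A_sum A_sym As sorted_s.
have A_symE l j : A l j = A j l by rewrite {1}A_sym mxE.
have A_sumT j : \sum_l A l j = 1 by under eq_bigr do rewrite A_symE.
have Kgt0 : (0 < K)%N by exact: leq_ltn_trans (ltn_ord k).
have K0 : K%:R != 0 :> R by rewrite pnatr_eq0 -lt0n.
have K1 : 0 <= 1 - K%:R^-1 :> R.
  by rewrite subr_ge0 invf_le1 ?ler1n ?ltr0n.
have [s1|s1] := leP 1 `|s`_1|.
  rewrite (sum_sqr_dev Kgt0)//; apply: le_trans (_ : 1 - K%:R^-1 <= _); last first.
    by rewrite ler_peMl// exprn_ege1.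
  rewrite lerD2r -(A_sumT k); apply: ler_sum => l _; rewrite expr2.
  rewrite ler_piMr//; rewrite -(A_sumT k) (bigD1 l)//= lerDl sumr_ge0//.
pose f := real_complex R; pose AC := map_mx f A.
case: s As sorted_s s1 => [|s0 s] As sorted_s s1.
  have := size_char_poly A; rewrite As big_nil size_poly1 => -[K0'].
  by have := Kgt0; rewrite -[X in (0 < X)%N]K0'.
have normf x : `|f x| = f `|x| by rewrite normc_def /= expr0n/= addr0 sqrtr_sqr.
have s_le : {in map f s, forall x, `|x| <= f `|(s0 :: s)`_1|}.
  move=> _ /mapP[x xs ->]; rewrite normf lecR.
  case: s xs sorted_s {As s1} => //= a s; rewrite inE => /orP[/eqP->//|xs].
  move=> /andP[_]; rewrite path_sortedE; last first.
    by move=> ? ? ? h1 h2; exact: le_trans h2 h1.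
  by move=> /andP[/allP/(_ _ xs)].
have AC_normal : AC \is normalmx.
  apply: symmetric_normalmx.
    by apply/is_hermitianmxP; apply/matrixP => i j; rewrite !mxE/= mul1r A_symE.
  by apply/mxOverP => i j; rewrite mxE complex_real.
have ACs : char_poly AC = \prod_(x <- f s0 :: map f s) ('X - x%:P).
  rewrite -map_char_poly As rmorph_prod -map_cons big_map.
  by apply: eq_bigr => x _; rewrite rmorphB/= map_polyX map_polyC.
(* [w] is the [k]-th unit vector minus its projection on the constants: [w *m A] lists the
   deviations of column [k], and [w] has squared norm [1 - 1/K]. *)
pose v : 'rV[R]_K := const_mx 1; pose w : 'rV[R]_K := \row_l ((l == k)%:R - K%:R^-1).
have sum_delta : \sum_l (l == k)%:R = 1 :> R.
  by rewrite (bigD1 k)//= eqxx big1 ?addr0// => i /negPf->.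
have vA : v *m A = v.
  by apply/rowP => i; rewrite !mxE; under eq_bigr do rewrite mxE mul1r.
have v0 : v != 0.
  by apply/eqP => /matrixP/(_ 0 k); rewrite !mxE => /eqP; rewrite oner_eq0.
have wv : w *m v^T = 0.
  apply/rowP => i; rewrite !mxE; under eq_bigr do rewrite !mxE mulr1.
  by rewrite sumrB sum_delta sumr_const card_ord -[_ *+ K]mulr_natr mulVf// subrr.
have wA l : (w *m A) 0 l = A l k - K%:R^-1.
  rewrite !mxE; under eq_bigr do rewrite !mxE mulrBl.
  rewrite sumrB -mulr_sumr A_sumT mulr1 (bigD1 k)//= eqxx mul1r big1 ?addr0.
    by rewrite A_symE.
  by move=> i /negPf->; rewrite mul0r.
have := @normal_orth_contract _ _ AC _ _ _ (map_mx f v) (map_mx f w)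
  AC_normal ACs s_le.
rewrite ler0c normr_ge0 -[X in _ < X]/(f 1) ltcR => /(_ isT s1).
rewrite -map_mxM vA => /(_ erefl); rewrite map_mx_eq0 => /(_ v0).
have -> : map_mx Num.conj (map_mx f v)^T = map_mx f v^T.
  by apply/matrixP => i j; rewrite !mxE; exact: conjc_real.
rewrite -map_mxM wv map_mx0 => /(_ erefl).
rewrite -map_mxM.
under eq_bigr => i _ do rewrite mxE normf -rmorphXn/= real_normK ?num_real// wA.
under [X in _ <= _ * X]eq_bigr => i _ do
  rewrite mxE normf -rmorphXn/= real_normK ?num_real// mxE.
rewrite -!rmorph_sum -rmorphXn -rmorphM/= lecR => /le_trans; apply.
rewrite (sum_sqr_dev Kgt0 sum_delta) ler_wpM2l ?exprn_ge0// lerD2r.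
by rewrite -[leRHS]sum_delta; apply: ler_sum => i _; case: eqP; rewrite ?expr1n ?expr0n.
Qed.

Lemma sum_dev_col_le (R : rcfType) K (A : 'M[R]_K) (gamma : R) (s : seq R) k :
  (forall l k, 0 <= A l k) -> (forall k, \sum_l A k l = 1) -> A = A^T ->
  0 < gamma ->
  char_poly A = \prod_(x <- s) ('X - x%:P) ->
  sorted (fun x y => `|y| <= `|x|) s ->
  \sum_l `|1 - gamma * A l k| <=
    Num.sqrt K%:R * gamma * Num.max `|1 - K%:R / gamma| `|s`_1|.
Proof.
move=> A_ge0 A_sum A_sym g0 As sorted_s.
have K0 : (0 < K)%N by exact: leq_ltn_trans (ltn_ord k).
have A_sumT : \sum_l A l k = 1.
  by rewrite -[RHS](A_sum k); apply: eq_bigr => l _; rewrite {1}A_sym mxE.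
set lam := Num.max _ _.
have lam0 : 0 <= lam by rewrite le_max normr_ge0.
have K1 : 0 < K%:R :> R by rewrite ltr0n.
rewrite -(ler_pXn2r (ltn0Sn 1)) ?nnegrE ?sumr_ge0 ?mulr_ge0 ?sqrtr_ge0 ?(ltW g0)//.
apply: (le_trans (sqr_sum_norm_le _)).
rewrite !exprMn sqr_sqrtr ?ler0n// -[leRHS]mulrA ler_pM2l//.
have -> : \sum_l (1 - gamma * A l k) ^+ 2 =
    gamma ^+ 2 * \sum_l (A l k - gamma^-1) ^+ 2.
  by rewrite mulr_sumr; apply: eq_bigr => l _; field; rewrite gt_eqF.
rewrite ler_pM2l ?exprn_gt0//.
(* Pythagoras: deviations from the mean [1/K] are orthogonal to the constant shift from [1/K] to
   [1/gamma]. *)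
have -> : \sum_l (A l k - gamma^-1) ^+ 2 = \sum_l (A l k - K%:R^-1) ^+ 2 +
    K%:R^-1 * `|1 - K%:R / gamma| ^+ 2.
  rewrite sum_sqr_dev// sum_sqr_sub A_sumT real_normK ?num_real//.
  by field; rewrite !gt_eqF.
have le1 := sum_sqr_dev_col_le k A_ge0 A_sum A_sym As sorted_s.
apply: le_trans (lerD le1 (lexx _)) _.
(* The two contributions carry weights [1 - 1/K] and [1/K], so bounding both squares by [lam ^+ 2]
   bounds the sum. *)
have sq (x : R) : 0 <= x -> x <= lam -> x ^+ 2 <= lam ^+ 2.
  by move=> x0 xl; rewrite lerXn2r ?nnegrE.
have s1l : `|s`_1| ^+ 2 <= lam ^+ 2 by apply: sq; rewrite ?le_max ?lexx ?orbT.
have gl : `|1 - K%:R / gamma| ^+ 2 <= lam ^+ 2 by apply: sq; rewrite ?le_max ?lexx.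
have iK : 0 <= K%:R^-1 :> R by rewrite invr_ge0 ltW.
have iK1 : K%:R^-1 <= 1 :> R by rewrite invf_le1 ?ler1n.
nra.
Qed.

(** * Convex functions as sums of hinges *)

Lemma ln_le_subr1 (R : realType) (x : R) : 0 < x -> ln x <= x - 1.
Proof.
move=> x0; have := @le_ln1Dx R (x - 1).
by rewrite (addrC 1) subrK; apply; lra.
Qed.

Section Hinge.
Variable R : realType.
Implicit Types (c x z : R) (cs : seq (R * R)).

(** Entries are (weight, node) pairs; nonnegative weights give convex piecewise linear functions. *)
Definition hinges cs x := \sum_(wc <- cs) wc.1 * Num.max (x - wc.2) 0.

Lemma hinges_eq0 cs c x : {in cs, forall wc, c <= wc.2} -> x <= c ->
  hinges cs x = 0.
Proof.
move=> csc xc; rewrite /hinges big_seq big1// => wc /csc cwc.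
by rewrite max_r ?mulr0// subr_le0 (le_trans xc).
Qed.

Lemma hinges_affine cs z x : {in cs, forall wc, wc.2 <= z} -> z <= x ->
  hinges cs x = hinges cs z + (\sum_(wc <- cs) wc.1) * (x - z).
Proof.
move=> csz zx; rewrite /hinges mulr_suml -big_split/= [LHS]big_seq [RHS]big_seq.
apply: eq_bigr => wc /csz cz; rewrite !max_l ?subr_ge0//; last exact: le_trans zx.
by ring.
Qed.

(* The last conjunct is the induction invariant: beyond the last node the
   graph of a convex function lies above the extension of its last chord. *)
Lemma hinge_interpolation (D : {pred R}) (g g' : R -> R) c0 (l : seq R) :
  {in D &, forall x y, g y + g' y * (x - y) <= g x} ->
  g c0 = 0 -> {in D, forall x, 0 <= g x} ->
  path <%R c0 l -> {subset c0 :: l <= D} ->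
  exists cs, [/\
    {in cs, forall wc, [/\ 0 <= wc.1, c0 <= wc.2 & wc.2 <= last c0 l]},
    {in c0 :: l, forall x, c0 <= x <= last c0 l},
    {in c0 :: l, forall x, g x = hinges cs x} &
    {in D, forall x, last c0 l <= x -> hinges cs x <= g x}].
Proof.
move=> tangent gc0 g_ge0; elim/last_ind: l => [_ _|l z' IH].
  exists [::]; split=> // [x|x|x Dx _]; last by rewrite /hinges big_nil g_ge0.
    by rewrite inE => /eqP->; rewrite lexx.
  by rewrite inE /hinges big_nil => /eqP->.
rewrite rcons_path => /andP[lP]; set z := last c0 l => zz' lD.
have Dl : {subset c0 :: l <= D}.
  by move=> x xl; apply: lD; rewrite -rcons_cons mem_rcons inE xl orbT.
have [cs [csP lz cs_eq cs_le]] := IH lP Dl; rewrite -/z in csP lz cs_le.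
have zl : z \in c0 :: l by exact: mem_last.
have Dz : z \in D by exact: Dl.
have Dz' : z' \in D by apply: lD; rewrite -rcons_cons mem_rcons inE eqxx.
have c0z : c0 <= z by have /andP[] := lz _ zl.
have dz : 0 < z' - z by rewrite subr_gt0.
have csz : {in cs, forall wc, wc.2 <= z} by move=> wc /csP[].
pose s := \sum_(wc <- cs) wc.1.
have hE x : z <= x -> hinges cs x = g z + s * (x - z).
  by move=> zx; rewrite (hinges_affine csz zx) -cs_eq.
(* The jump in slope at [z] needed to meet [g] at [z']; the invariant makes it nonnegative. *)
pose w := (g z' - hinges cs z') / (z' - z).
have w0 : 0 <= w by rewrite divr_ge0 ?(ltW dz)// subr_ge0 cs_le// ltW.
have wE : w * (z' - z) = g z' - hinges cs z' by rewrite divfK// gt_eqF.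
have h'E x : hinges ((w, z) :: cs) x = w * Num.max (x - z) 0 + hinges cs x.
  by rewrite /hinges big_cons.
rewrite last_rcons; exists ((w, z) :: cs); split.
- move=> wc; rewrite inE => /orP[/eqP->/=|/csP[? ? ?]]; split=> //.
    exact: ltW.
  by apply: le_trans (ltW zz').
- move=> x; rewrite -rcons_cons mem_rcons inE => /orP[/eqP->|/lz/andP[-> xz]].
    by rewrite lexx (le_trans c0z)// ltW.
  by rewrite (le_trans xz)// ltW.
- move=> x; rewrite -rcons_cons mem_rcons inE h'E => /orP[/eqP->|xl].
    by rewrite max_l ?(ltW dz)// wE subrK.
  have /andP[_ xz] := lz _ xl.
  by rewrite max_r ?subr_le0// mulr0 add0r -cs_eq.
- move=> x Dx z'x; have zx : z <= x by rewrite (le_trans (ltW zz')).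
  rewrite h'E max_l ?subr_ge0// hE//.
  (* The tangent at [z'], read at [z], bounds the slope of the last chord by [g' z']; read at [x],
     it keeps [g] above the extended chord. *)
  have tz := tangent _ _ Dz Dz'; have tx := tangent _ _ Dx Dz'.
  have ws : (w + s) * (z' - z) = g z' - g z by rewrite mulrDl wE hE ?ltW//; ring.
  have slope : w + s <= g' z'.
    by rewrite -(ler_pM2r dz) ws; move: tz; lra.
  have dx : 0 <= x - z' by rewrite subr_ge0.
  have := ler_wpM2r dx slope; move: tx ws; lra.
Qed.

Lemma hinge_interpolation_mem (D : {pred R}) (g g' : R -> R) c0 (l : seq R) :
  {in D &, forall x y, g y + g' y * (x - y) <= g x} ->
  g c0 = 0 -> {in D, forall x, 0 <= g x} -> c0 \in D -> {subset l <= D} ->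
  exists cs,
    {in cs, forall wc, 0 <= wc.1 /\ c0 <= wc.2} /\
    {in l, forall x, c0 <= x -> g x = hinges cs x}.
Proof.
move=> tangent gc0 g0 c0D lD.
pose l' := sort <=%R (undup [seq x <- l | c0 < x]).
have l'E x : (x \in l') = (c0 < x) && (x \in l).
  by rewrite mem_sort mem_undup mem_filter.
have l'P : path <%R c0 l'.
  rewrite path_sortedE; last exact: lt_trans.
  apply/andP; split; first by apply/allP => x; rewrite l'E => /andP[].
  by rewrite lt_sorted_uniq_le sort_uniq undup_uniq/= sort_le_sorted.
have [|cs [csP _ csE _]] := hinge_interpolation tangent gc0 g0 l'P.
  by move=> x; rewrite inE l'E => /orP[/eqP->//|/andP[_ /lD]].
exists cs; split=> [wc /csP[]//|x xl c0x]; apply: csE.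
by rewrite inE l'E xl andbT eq_sym -le_eqVlt.
Qed.

(** The convex function [x ln x - x + 1] has minimum 0 at 1, so its two branches are interpolated
    separately, the left one after reflection. The node bounds [1] and [-1] later make the relevant
    total masses nonpositive. *)
Lemma xlnx_hinges (l : seq R) : {subset l <= (fun x => 0 < x)} ->
  exists cs ds, [/\
    {in cs, forall wc, 0 <= wc.1 /\ 1 <= wc.2},
    {in ds, forall wc, 0 <= wc.1 /\ -1 <= wc.2} &
    {in l, forall x, x * ln x - x + 1 = hinges cs x + hinges ds (- x)}].
Proof.
move=> l0; pose f x : R := x * ln x - x + 1.
(* The derivative at [y] is [ln y], and the claim is [ln (y / x) <= y / x - 1] multiplied by [x]. *)
have tangent x y : 0 < x -> 0 < y -> f y + ln y * (x - y) <= f x.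
  move=> x0 y0; have := @ln_le_subr1 R (y / x) (divr_gt0 y0 x0).
  rewrite ln_div ?posrE// -(ler_pM2l x0) /f.
  have -> : x * (y / x - 1) = y - x by field; rewrite gt_eqF.
  lra.
have f1 : f 1 = 0 by rewrite /f ln1; ring.
have f_ge0 x : 0 < x -> 0 <= f x.
  by move=> x0; have := tangent _ _ x0 ltr01; rewrite f1 ln1; lra.
have [cs [csP csE]] := @hinge_interpolation_mem (fun x => 0 < x) f (@ln R) 1 l
  (fun x y => @tangent x y) f1 f_ge0 ltr01 l0.
have [|||||ds [dsP dsE]] := @hinge_interpolation_mem (fun x => x < 0)
  (fun x => f (- x)) (fun x => - ln (- x)) (-1) (map -%R l).
- move=> x y; rewrite !unfold_in => x0 y0.
  by have := @tangent (- x) (- y); rewrite !oppr_gt0 => /(_ x0 y0); lra.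
- by rewrite opprK.
- by move=> x; rewrite unfold_in => x0; rewrite f_ge0// oppr_gt0.
- by rewrite unfold_in oppr_lt0 ltr01.
- by move=> _ /mapP[x /l0 x0 ->]; rewrite unfold_in oppr_lt0.
exists cs, ds; split=> // x xl; rewrite -/(f x).
have [x1|x1] := leP x 1; last first.
  rewrite (csE _ xl (ltW x1)) [X in _ + X](@hinges_eq0 _ (-1)) ?addr0//.
    by move=> ? /dsP[].
  by rewrite lerN2 ltW.
rewrite (@hinges_eq0 cs 1) ?add0r//; last by move=> ? /csP[].
by rewrite -dsE ?lerN2 ?opprK// map_f.
Qed.
End Hinge.

(** * Strong data processing for the Kullback-Leibler divergence *)

Section DataProcessing.
Variables (R : realType) (H : nat) (T : 'I_H -> 'I_H -> R).
Hypothesis T_ge0 : forall th th', 0 <= T th th'.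
Hypothesis T_sum : forall th', \sum_th T th th' = 1.
Implicit Types p q v : 'I_H -> R.

Lemma dobrushin_ge0 : 0 <= dobrushin T.
Proof. by rewrite /dobrushin; apply: bigmax_ge_id. Qed.

(** The two columns have equal sums, so the positive part of their difference carries half of its
    absolute mass. *)
Lemma sum_pos_part_le_dobrushin t1 t2 :
  \sum_th Num.max (T th t1 - T th t2) 0 <= dobrushin T.
Proof.
have -> : \sum_th Num.max (T th t1 - T th t2) 0 =
    2^-1 * \sum_th `|T th t1 - T th t2|.
  have -> : \sum_th Num.max (T th t1 - T th t2) 0 = \sum_th
      (2^-1 * `|T th t1 - T th t2| + 2^-1 * (T th t1 - T th t2)).
    apply: eq_bigr => th _; have [h|] := boolP (0 <= T th t1 - T th t2).
      by rewrite max_l// ger0_norm//; field.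
    by rewrite -ltNge => h; rewrite max_r ?ltW// ltr0_norm//; field.
  by rewrite big_split/= -!mulr_sumr sumrB !T_sum subrr mulr0 addr0.
rewrite /dobrushin.
apply: le_trans (le_bigmax _ (fun t1 => \big[Num.max/0]_(t2 < H)
  (2^-1 * \sum_th `|T th t1 - T th t2|)) t1).
exact: (le_bigmax _ (fun t2 => 2^-1 * \sum_th `|T th t1 - T th t2|)).
Qed.

Lemma predict_sum v : \sum_th predict T v th = \sum_th v th.
Proof.
rewrite /predict exchange_big/=; apply: eq_bigr => th' _.
by rewrite -mulr_suml T_sum mul1r.
Qed.

Lemma predictZB c p q th :
  predict T (fun t => p t - c * q t) th = predict T p th - c * predict T q th.
Proof.
by rewrite /predict mulr_sumr -sumrB; apply: eq_bigr => t _; ring.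
Qed.

(* When the negative part of [v] outweighs its positive part, the latter is
   transported against a fraction of the former. *)
Lemma pos_part_contract v : \sum_th v th <= 0 ->
  \sum_th Num.max (predict T v th) 0 <= dobrushin T * \sum_th Num.max (v th) 0.
Proof.
move=> v0; pose a th := Num.max (v th) 0; pose b th := Num.max (- v th) 0.
have a0 th : 0 <= a th by rewrite le_max lexx orbT.
have b0 th : 0 <= b th by rewrite le_max lexx orbT.
have vE th : v th = a th - b th.
  rewrite /a /b; case: (leP 0 (v th)) => h.
    by rewrite max_r ?subr0// oppr_le0.
  by rewrite max_l ?sub0r ?opprK// oppr_ge0 ltW.
rewrite -/a; set m := \sum_th a th; set M := \sum_th b th.
have mM : m <= M by rewrite -subr_le0 -sumrB; under eq_bigr do rewrite -vE.
have m0 : 0 <= m by exact: sumr_ge0.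
have M0 : 0 <= M by exact: sumr_ge0.
have predE th : predict T v th = \sum_t T th t * a t - \sum_t T th t * b t.
  by rewrite -sumrB; apply: eq_bigr => t _; rewrite vE mulrBr.
have Tb0 th : 0 <= \sum_t T th t * b t by apply: sumr_ge0 => t _; rewrite mulr_ge0.
have [m_eq0|m_neq0] := eqVneq m 0.
  rewrite m_eq0 mulr0 big1// => th _; rewrite max_r// predE big1 ?sub0r ?oppr_le0//.
  move=> t _; have /eqP := m_eq0; rewrite psumr_eq0// => /allP/(_ t).
  by rewrite mem_index_enum => /(_ isT) /eqP->; rewrite mulr0.
have mpos : 0 < m by rewrite lt_neqAle eq_sym m_neq0.
have Mpos : 0 < M by exact: lt_le_trans mM.
(* Product coupling: the mass [a t] is matched with each [t'] in proportion [b t' / M]. Since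
   [m <= M], this subtracts only the fraction [m / M] of the negative part, which can only enlarge
   the sum. *)
apply: le_trans (_ : \sum_th M^-1 * (\sum_t \sum_t'
    a t * b t' * Num.max (T th t - T th t') 0) <= _).
  apply: ler_sum => th _.
  have ab0 t t' : 0 <= a t * b t' * Num.max (T th t - T th t') 0.
    by rewrite !mulr_ge0// le_max lexx orbT.
  rewrite ge_max [X in _ && X]mulr_ge0 ?invr_ge0 ?andbT//; last first.
    by apply: sumr_ge0 => t _; exact: sumr_ge0.
  apply: le_trans (_ : M^-1 * (\sum_t \sum_t' a t * b t' * (T th t - T th t')) <= _).
    have -> : \sum_t \sum_t' a t * b t' * (T th t - T th t') =
        (\sum_t T th t * a t) * M - m * \sum_t' T th t' * b t'.
      rewrite /M /m !mulr_suml -sumrB; apply: eq_bigr => t _.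
      by rewrite !mulr_sumr -sumrB; apply: eq_bigr => t' _; ring.
    rewrite mulrBr [M^-1 * _]mulrC mulfK ?gt_eqF// predE lerD2l lerN2 mulrA.
    by rewrite ler_piMl// mulrC ler_pdivrMr// mul1r.
  rewrite ler_wpM2l ?invr_ge0//; apply: ler_sum => t _; apply: ler_sum => t' _.
  by rewrite ler_wpM2l ?mulr_ge0// le_max lexx.
rewrite -mulr_sumr exchange_big/=; under eq_bigr do rewrite exchange_big/=.
apply: le_trans (_ : M^-1 * (\sum_t \sum_t' a t * b t' * dobrushin T) <= _).
  rewrite ler_wpM2l ?invr_ge0//; apply: ler_sum => t _; apply: ler_sum => t' _.
  by rewrite -mulr_sumr ler_wpM2l ?mulr_ge0// sum_pos_part_le_dobrushin.
under eq_bigr do rewrite -mulr_suml -mulr_sumr.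
rewrite -!mulr_suml -/m -/M le_eqVlt; apply/orP; left; apply/eqP.
by field; rewrite gt_eqF.
Qed.

(** Adding the null total of [q - p] gives the f-divergence form for the nonnegative function
    [x ln x - x + 1]. *)
Lemma KLdE p q : (forall th, 0 < q th) ->
  \sum_th p th = \sum_th q th ->
  KLd p q = \sum_th q th * ((p th / q th) * ln (p th / q th) - p th / q th + 1).
Proof.
move=> q0 pq; have -> : KLd p q = KLd p q - \sum_th p th + \sum_th q th.
  by rewrite pq subrK.
rewrite /KLd -sumrB -big_split/=; apply: eq_bigr => th _; field.
by rewrite gt_eqF.
Qed.

Lemma KLd_ge0 p q : (forall th, 0 < p th) -> (forall th, 0 < q th) ->
  \sum_th p th = \sum_th q th -> 0 <= KLd p q.
Proof.
move=> p0 q0 pq; have -> : 0 = \sum_th (p th - q th) by rewrite sumrB pq subrr.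
apply: ler_sum => th _.
have := ler_wpM2l (ltW (p0 th)) (ln_le_subr1 (divr_gt0 (q0 th) (p0 th))).
have -> : p th * (q th / p th - 1) = q th - p th by field; rewrite gt_eqF.
by rewrite !ln_div ?posrE//; lra.
Qed.

(** Both divergences are the same nonnegative combination of hinge divergences
    [\sum_th Num.max (p th - c * q th) 0] and their reflections, and [pos_part_contract] shrinks
    each of them. *)
Lemma KLd_predict_le p q : (forall th, 0 < p th) -> (forall th, 0 < q th) ->
  \sum_th p th = 1 -> \sum_th q th = 1 ->
  (forall th, 0 < predict T p th) -> (forall th, 0 < predict T q th) ->
  KLd (predict T p) (predict T q) <= dobrushin T * KLd p q.
Proof.
move=> p0 q0 p1 q1 Tp0 Tq0.
rewrite !KLdE ?predict_sum ?p1 ?q1//.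
set P := predict T p; set Q := predict T q.
(* One family of hinges must serve both sides, so the ratios before and after the transition are all
   interpolated. *)
pose l := [seq p th / q th | th : 'I_H] ++ [seq P th / Q th | th : 'I_H].
have [|cs [ds [csP dsP fE]]] := @xlnx_hinges R l.
  by move=> x; rewrite mem_cat => /orP[] /mapP[th _ ->]; rewrite unfold_in divr_gt0.
have pl th : p th / q th \in l.
  by rewrite mem_cat; apply/orP; left; apply/mapP; exists th; rewrite ?mem_enum.
have Pl th : P th / Q th \in l.
  by rewrite mem_cat; apply/orP; right; apply/mapP; exists th; rewrite ?mem_enum.
have maxM (x y c : R) : 0 < y -> y * Num.max (x / y - c) 0 = Num.max (x - c * y) 0.
  move=> y0; rewrite maxr_pMr ?ltW// mulr0; congr Num.max; field.
  by rewrite gt_eqF.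
have hingesM us (x y : 'I_H -> R) : (forall th, 0 < y th) ->
    \sum_th y th * hinges us (x th / y th) =
    \sum_(wc <- us) wc.1 * \sum_th Num.max (x th - wc.2 * y th) 0.
  move=> y0; under eq_bigr do rewrite /hinges mulr_sumr.
  rewrite exchange_big/=; apply: eq_bigr => wc _; rewrite mulr_sumr.
  by apply: eq_bigr => th _; rewrite mulrCA maxM.
have split_hinges (x y : 'I_H -> R) : (forall th, 0 < y th) ->
    (forall th, x th / y th \in l) ->
    \sum_th y th * (x th / y th * ln (x th / y th) - x th / y th + 1) =
    \sum_(wc <- cs) wc.1 * (\sum_th Num.max (x th - wc.2 * y th) 0) +
    \sum_(wc <- ds) wc.1 * (\sum_th Num.max (- x th - wc.2 * y th) 0).
  move=> y0 xl; under eq_bigr do rewrite fE// mulrDr -mulNr.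
  by rewrite big_split/= hingesM// (hingesM _ (fun th => - x th)).
rewrite !split_hinges// mulrDr !mulr_sumr.
rewrite !big_seq; apply: lerD; apply: ler_sum => wc.
  (* The total mass is [1 - c] here and [-1 - c] for the reflected family, nonpositive by the node
     bounds. *)
  move=> /csP[w0 c1]; rewrite mulrCA ler_wpM2l//.
  under eq_bigr do rewrite -predictZB; apply: pos_part_contract.
  by rewrite sumrB -mulr_sumr p1 q1; lra.
move=> /dsP[w0 c1]; rewrite mulrCA ler_wpM2l//.
have PN th : - P th - wc.2 * Q th = predict T (fun t => - p t - wc.2 * q t) th.
  rewrite (predictZB _ (fun t => - p t)); congr (_ - _).
  by rewrite /P /predict -sumrN; apply: eq_bigr => t _; rewrite mulrN.
under eq_bigr do rewrite PN; apply: pos_part_contract.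
by rewrite sumrB sumrN -mulr_sumr p1 q1; lra.
Qed.
End DataProcessing.

(** * One step of the two filters *)

Section Normalize.
Variables (R : realType) (H : nat).
Implicit Types f p q : 'I_H -> R.

Lemma sum_gt0 f (th : 'I_H) : (forall th, 0 < f th) -> 0 < \sum_t f t.
Proof.
move=> f0; rewrite (bigD1 th)//= ltr_pwDl// sumr_ge0// => t _.
exact: ltW.
Qed.

Lemma normalize_gt0 f th : (forall th, 0 < f th) -> 0 < normalize f th.
Proof. by move=> f0; rewrite divr_gt0// sum_gt0. Qed.

Lemma normalize_sum1 f : \sum_th f th != 0 -> \sum_th normalize f th = 1.
Proof. by move=> f0; rewrite -mulr_suml mulfV. Qed.

Lemma normalizeZ c f : c != 0 -> normalize (fun th => c * f th) =1 normalize f.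
Proof. by move=> c0 th; rewrite /normalize -mulr_sumr -mulf_div divff ?mul1r. Qed.

Lemma eq_normalize f p : f =1 p -> normalize f =1 normalize p.
Proof.
by move=> fp th; rewrite /normalize fp; congr (_ / _); apply: eq_bigr.
Qed.

Lemma ln_normalize f th : (forall th, 0 < f th) ->
  ln (normalize f th) = ln (f th) - ln (\sum_t f t).
Proof. by move=> f0; rewrite ln_div// posrE// (sum_gt0 th). Qed.
End Normalize.

Section LogPool.
Variables (R : realType) (K : nat).
Implicit Types a x : 'I_K -> R.

Lemma prod_expR_sum x : (forall j, 0 < x j) ->
  \prod_j x j = expR (\sum_j ln (x j)).
Proof.
by move=> x0; rewrite expR_sum; apply: eq_bigr => j _; rewrite lnK ?posrE.
Qed.

Lemma prod_powR_expR a x : (forall j, 0 <= a j) -> (forall j, 0 < x j) ->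
  \prod_(j < K | 0 < a j) x j `^ a j = expR (\sum_j a j * ln (x j)).
Proof.
move=> a0 x0; rewrite expR_sum big_mkcond/=; apply: eq_bigr => j _.
rewrite lt_def a0 andbT; case: eqP => [->|_]; first by rewrite mul0r expR0.
by rewrite /powR gt_eqF.
Qed.

(** Average [ln (x j / m) <= x j / m - 1], with [m] the arithmetic mean. *)
Lemma geo_le_arith_mean a x : (forall j, 0 <= a j) -> \sum_j a j = 1 ->
  (forall j, 0 < x j) ->
  expR (\sum_j a j * ln (x j)) <= \sum_j a j * x j.
Proof.
move=> a0 a1 x0; set m := \sum_j a j * x j.
have ax0 j : 0 <= a j * x j by rewrite mulr_ge0// ltW.
have m0 : 0 < m.
  rewrite lt_neqAle sumr_ge0// andbT; apply: contra_eq_neq a1 => /esym/eqP.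
  rewrite psumr_eq0// => /allP ax; rewrite big1 1?eq_sym ?oner_eq0// => j _.
  have := ax j; rewrite mem_index_enum => /(_ isT)/eqP/eqP.
  by rewrite mulf_eq0 [x j == 0]gt_eqF// orbF => /eqP.
rewrite -[leRHS]lnK ?posrE// ler_expR -subr_le0 -[ln m]mul1r -a1 mulr_suml -sumrB.
apply: le_trans (_ : \sum_j a j * (x j / m - 1) <= _).
  apply: ler_sum => j _; rewrite -mulrBr ler_wpM2l// -ln_div ?posrE//.
  by apply: ln_le_subr1; rewrite divr_gt0.
under eq_bigr do rewrite mulrBr mulr1 mulrA.
by rewrite sumrB a1 -mulr_suml -/m divff ?gt_eqF// subrr.
Qed.
End LogPool.

Section OneStep.
Variables (R : realType) (H K : nat) (a : 'I_K -> R) (gamma B C : R).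
Variables (l eta : 'I_K -> 'I_H -> R) (es : 'I_H -> R).
Hypotheses (a0 : forall j, 0 <= a j) (a1 : \sum_j a j = 1).
Hypotheses (l0 : forall j th, 0 < l j th) (lC : forall j th, `|ln (l j th)| <= C).
Hypotheses (eta0 : forall j th, 0 < eta j th) (es0 : forall th, 0 < es th).
Hypothesis aB : (\sum_j `|1 - gamma * a j|) * C <= B.

Let Lj th := \prod_j l j th.
Let m := \sum_th Lj th * es th.
Let mix th := \sum_j a j * eta j th.

(** [m] is the predictive density of the new observation. Multiplying by it makes the right-hand
    side linear in [Lj], so that integrating the observation out only requires summing the
    coefficients. *)
Lemma KLd_step_le :
  m * KLd (normalize (fun th => Lj th * es th))
          (normalize (fun th => \prod_(j < K | 0 < a j)
             (normalize (fun th => (l j th) `^ gamma * eta j th) th) `^ a j))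
  <= \sum_th (es th * (\sum_j a j * ln (es th / eta j th)) +
       2 * B * es th + mix th - es th) * Lj th.
Proof.
have Lj0 th : 0 < Lj th by apply: prodr_gt0.
have f0 th : 0 < Lj th * es th by rewrite mulr_gt0.
pose g j th := (l j th) `^ gamma * eta j th.
have g0 j th : 0 < g j th by rewrite mulr_gt0// powR_gt0.
pose u th := \sum_j a j * (gamma * ln (l j th) + ln (eta j th)).
pose c := \sum_j a j * ln (\sum_th g j th).
set q := normalize (fun th => \prod_(j < K | _) _).
(* The agents' own normalizing constants give a common factor [expR (- c)], which the outer
   normalization cancels. *)
have qE : q =1 normalize (fun th => expR (u th)).
  move=> th; rewrite -(@normalizeZ _ _ (expR (- c))) ?gt_eqF ?expR_gt0//.
  apply: eq_normalize => {}th; rewrite prod_powR_expR//; last first.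
    by move=> j; apply: normalize_gt0 => t; exact: g0.
  rewrite -expRD; congr expR; rewrite /c /u -sumrN -big_split/=.
  apply: eq_bigr => j _; rewrite (@ln_normalize _ _ (g j))// {1}/g lnM ?posrE ?powR_gt0// ln_powR.
  by ring.
pose N := \sum_th Lj th * mix th.
pose delta th := \sum_j (1 - gamma * a j) * ln (l j th).
have deltaB th : `|delta th| <= B.
  apply: le_trans aB; apply: le_trans (ler_norm_sum _ _ _) _.
  rewrite mulr_suml; apply: ler_sum => j _; rewrite normrM.
  by rewrite ler_wpM2l.
have uE th : u th = ln (Lj th) - delta th + \sum_j a j * ln (eta j th).
  rewrite /Lj prod_expR_sum// expRK /delta /u -sumrB -big_split/=.
  by apply: eq_bigr => j _; ring.
have mix0 th : 0 < mix th.
  exact: lt_le_trans (expR_gt0 _) (geo_le_arith_mean a0 a1 (fun j => eta0 j th)).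
have u_le th : expR (u th) <= expR B * (Lj th * mix th).
  rewrite uE expRD mulrA ler_pM ?expR_ge0//.
    rewrite addrC expRD lnK ?posrE// ler_wpM2r ?(ltW (Lj0 _))//.
    by rewrite ler_expR lerNl; have := deltaB th; rewrite ler_norml => /andP[].
  exact: geo_le_arith_mean.
pose Z := \sum_th expR (u th).
(* One [B] bounds the pointwise defect [delta]; the other compares the pooled normalizer [Z] with
   [N]. *)
have key th : ln (normalize (fun th => Lj th * es th) th / q th) <=
    \sum_j a j * ln (es th / eta j th) + 2 * B + N / m - 1.
  have m0 : 0 < m by exact: sum_gt0.
  have Lm0 t : 0 < Lj t * mix t by rewrite mulr_gt0.
  have N0 : 0 < N by exact: sum_gt0.
  have Z0 : 0 < Z by apply: sum_gt0 => // t; exact: expR_gt0.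
  have q0 : 0 < q th by rewrite qE normalize_gt0// => t; exact: expR_gt0.
  have ZN : ln Z <= B + ln N.
    rewrite -[B]expRK -lnM ?posrE ?expR_gt0// ler_ln ?posrE ?mulr_gt0 ?expR_gt0//.
    by rewrite mulr_sumr; apply: ler_sum => t _; exact: u_le.
  have Nm : ln N - ln m <= N / m - 1.
    by rewrite -ln_div ?posrE//; apply: ln_le_subr1; rewrite divr_gt0.
  have p0 : 0 < normalize (fun th => Lj th * es th) th by exact: normalize_gt0.
  rewrite (ln_div p0 q0) qE !ln_normalize//; last first.
    by move=> t; exact: expR_gt0.
  rewrite -/m -/Z expRK lnM ?posrE// uE.
  have -> : \sum_j a j * ln (es th / eta j th) =
      ln (es th) - \sum_j a j * ln (eta j th).
    rewrite -[ln (es th)]mul1r -a1 mulr_suml -sumrB; apply: eq_bigr => j _.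
    by rewrite ln_div ?posrE// mulrBr.
  by have := deltaB th; rewrite ler_norml => /andP[]; move: ZN Nm; lra.
have [H0|H0] := posnP H.
  rewrite /m /KLd !big1 ?mulr0// => th _; by have := ltn_ord th; rewrite {2}H0.
have m0 : 0 < m by exact: (sum_gt0 (Ordinal H0)).
rewrite /KLd mulr_sumr; apply: le_trans (_ : \sum_th Lj th * es th *
   (\sum_j a j * ln (es th / eta j th) + 2 * B + N / m - 1) <= _).
  apply: ler_sum => th _; rewrite mulrA {1}/normalize -/m.
  rewrite [m * _]mulrC divfK ?gt_eqF// ler_wpM2l// ltW//.
rewrite le_eqVlt; apply/orP; left; apply/eqP.
transitivity (\sum_th Lj th * es th * (\sum_j a j * ln (es th / eta j th) + 2 * B - 1)
   + m * (N / m)).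
  rewrite [m * _]mulr_suml -big_split/=.
  by apply: eq_bigr => th _; ring.
rewrite mulrCA divff ?gt_eqF// mulr1 /N -big_split/=.
by apply: eq_bigr => th _; ring.
Qed.
End OneStep.

(** * Iterated integrals *)

Section IteratedIntegral.
Variables (R : realType) (d : measure_display) (X : measurableType d).
Local Open Scope ereal_scope.

(* No measurability is required: the integral of a nonnegative function is a
   supremum over the simple functions below it. *)
Lemma ge0_le_integral_nomeas (mu : {measure set X -> \bar R}) (f g : X -> \bar R) :
  (forall x, 0 <= f x) -> (forall x, f x <= g x) ->
  \int[mu]_x f x <= \int[mu]_x g x.
Proof.
move=> f0 fg; have g0 x : 0 <= g x by exact: le_trans (fg x).
rewrite !ge0_integralTE//; apply: ereal_sup_le => _ [h /= hf <-].
by exists h => //= x; exact: le_trans (hf x) (fg x).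
Qed.

Lemma iter_int_ge0 (ms : seq {measure set X -> \bar R}) h :
  (forall b, size b = size ms -> 0 <= h b) -> 0 <= iter_int ms h.
Proof.
elim: ms h => [|m ms IH] h h0 /=; first exact: h0.
by apply: integral_ge0 => x _; apply: IH => b bs; apply: h0; rewrite /= bs.
Qed.

Lemma le_iter_int (ms : seq {measure set X -> \bar R}) h1 h2 :
  (forall b, size b = size ms -> 0 <= h1 b) ->
  (forall b, size b = size ms -> h1 b <= h2 b) ->
  iter_int ms h1 <= iter_int ms h2.
Proof.
elim: ms h1 h2 => [|m ms IH] h1 h2 h0 h12 /=; first exact: h12.
apply: ge0_le_integral_nomeas => x.
  by apply: iter_int_ge0 => b bs; apply: h0; rewrite /= bs.
by apply: IH => b bs; [apply: h0|apply: h12]; rewrite /= bs.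
Qed.

Variables (K : nat) (nu : 'I_K -> {measure set X -> \bar R}).

Lemma nest_int_ge0 n h : (forall s, 0 <= h s) -> 0 <= nest_int nu n h.
Proof.
elim: n h => [|n IH] h h0 /=; first exact: h0.
by apply: iter_int_ge0 => b _; apply: IH.
Qed.

Lemma le_nest_int n h1 h2 : (forall s, 0 <= h1 s) -> (forall s, h1 s <= h2 s) ->
  nest_int nu n h1 <= nest_int nu n h2.
Proof.
elim: n h1 h2 => [|n IH] h1 h2 h0 h12 /=; first exact: h12.
apply: le_iter_int => b _; first exact: nest_int_ge0.
exact: IH.
Qed.

(** [nest_int] exposes the first observation, whereas the filters are updated by the last one; here
    the last is integrated innermost, given its past. *)
Lemma nest_int_rcons n h :
  nest_int nu n.+1 h = nest_int nu n (fun s =>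
    iter_int [seq nu k | k <- enum 'I_K] (fun b => h (rcons s (jobs_of b)))).
Proof.
elim: n h => [//|n IH] h.
congr iter_int; apply/funext => b; exact: (IH (fun s => h (jobs_of b :: s))).
Qed.

Variables (H : nat) (L : 'I_K -> 'I_H -> X -> R).
Hypothesis L_meas : forall k th, measurable_fun setT (L k th).
Hypothesis L_ge0 : forall k th x, (0 <= L k th x)%R.
Hypothesis L_int1 : forall k th, \int[nu k]_x (L k th x)%:E = 1.

Lemma integral_lin_lik k (c : 'I_H -> R) :
  \int[nu k]_x (\sum_th c th * L k th x)%R%:E = (\sum_th c th)%R%:E.
Proof.
have Lint th : (nu k).-integrable setT (EFin \o L k th).
  apply/integrableP; split; first exact/measurable_realfun.measurable_EFinP.
  rewrite (_ : (fun _ => _) = fun x => (L k th x)%:E) ?L_int1 ?ltry//.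
  by apply/funext => x /=; rewrite ger0_norm.
under eq_integral do rewrite -sumEFin.
rewrite integral_sum//; last first.
  by move=> th; exact: (integrableZl measurableT (c th) (Lint th)).
rewrite -sumEFin; apply: eq_bigr => th _; rewrite -[RHS]mule1 -(L_int1 k th).
exact: (integralZl measurableT (Lint th) (c th)).
Qed.

(** Induction on the agents: the likelihood of the outer agent is absorbed into the coefficients,
    then integrates to one. *)
Lemma iter_int_lin_lik (c : 'I_H -> R) :
  iter_int [seq nu k | k <- enum 'I_K]
    (fun b => (\sum_th c th * Ljoint L (jobs_of b) th)%R%:E) =
  (\sum_th c th)%R%:E.
Proof.
pose pL ks b th : R := (\prod_(kx <- zip ks b) L kx.1 th kx.2)%R.
have pLE ks : iter_int [seq nu k | k <- ks]
    (fun b => (\sum_th c th * pL ks b th)%R%:E) = (\sum_th c th)%R%:E.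
  elim: ks c => [|k ks IH] c' /=.
    by congr EFin; apply: eq_bigr => th _; rewrite /pL big_nil mulr1.
  rewrite -(integral_lin_lik k); apply: eq_integral => x _.
  rewrite -IH; congr iter_int; apply/funext => b; congr EFin.
  by apply: eq_bigr => th _; rewrite /pL /= big_cons mulrA.
rewrite -(pLE (enum 'I_K)).
(* Only lists with one entry per agent are reached; on these [jobs_of] never returns the default
   [point]. *)
suff E b : size b = size [seq nu k | k <- enum 'I_K] ->
    (\sum_th c th * Ljoint L (jobs_of b) th)%R%:E =
    (\sum_th c th * pL (enum 'I_K) b th)%R%:E.
  have ext (ms : seq {measure set X -> \bar R}) h1 h2 :
      (forall b, size b = size ms -> h1 b = h2 b) -> iter_int ms h1 = iter_int ms h2.
    elim: ms h1 h2 => [|m ms IH] h1 h2 h12 /=; first exact: h12.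
    by apply: eq_integral => x _; apply: IH => b' bs; apply: h12; rewrite /= bs.
  exact: ext.
rewrite size_map size_enum_ord => bK; congr EFin; apply: eq_bigr => th _.
congr (_ * _)%R; rewrite /Ljoint /pL.
have bE : b = [seq nth point b k | k : 'I_K].
  rewrite -[LHS](mkseq_nth point) /mkseq bK -val_enum_ord -map_comp.
  exact: eq_map.
have -> : zip (enum 'I_K) b = [seq (k, nth point b k) | k : 'I_K].
  by rewrite {1}bE; have := zip_map id (fun k : 'I_K => nth point b k) (enum 'I_K); rewrite map_id.
by rewrite big_map big_enum.
Qed.
End IteratedIntegral.

(** * Risk recursion *)

Section Filter.
Variables (R : realType) (d : measure_display) (X : measurableType d).
Variables (H K : nat) (T : 'I_H -> 'I_H -> R) (mu0_star : 'I_H -> R).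
Variables (nu : 'I_K -> {measure set X -> \bar R}) (L : 'I_K -> 'I_H -> X -> R).
Variables (C_L : R) (A : 'M[R]_K) (gamma : R) (mu0 : 'I_K -> 'I_H -> R) (B : R).
Hypotheses (T_ge0 : forall th th', 0 <= T th th')
  (T_sum : forall th', \sum_(th < H) T th th' = 1)
  (T_row : forall th, exists th', 0 < T th th').
Hypotheses (mu0_star_gt0 : forall th, 0 < mu0_star th)
  (mu0_star_sum : \sum_(th < H) mu0_star th = 1).
Hypotheses (L_meas : forall k th, measurable_fun setT (L k th))
  (L_ge0 : forall k th x, 0 <= L k th x)
  (L_int1 : forall k th, (\int[nu k]_x (L k th x)%:E = 1)%E)
  (L_bound : forall k th x, (exists th', 0 < L k th' x) ->
    0 < L k th x /\ `|ln (L k th x)| <= C_L).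
Hypotheses (A_ge0 : forall l k, 0 <= A l k)
  (A_sum : forall k, \sum_(l < K) A l k = 1).
Hypotheses (mu0_gt0 : forall k th, 0 < mu0 k th)
  (mu0_sum : forall k, \sum_(th < H) mu0 k th = 1).
Hypotheses (B_ge0 : 0 <= B)
  (A_dev : forall k, (\sum_j `|1 - gamma * A j k|) * C_L <= B).

Notation kappa := (dobrushin T).
Notation joint_obs := ('I_K -> X).
Notation alpha := (foldl (fwd T L) mu0_star).
Notation dens := (obs_density T L mu0_star).
Notation mus := (mu_star T L mu0_star).
Notation mu := (dhs T L A gamma mu0).
Implicit Types (s : seq joint_obs) (xi : joint_obs) (w : 'I_K -> R).

Lemma predict_gt0 p th : (forall t, 0 < p t) -> 0 < predict T p th.
Proof.
move=> p0; have [t Tt] := T_row th; rewrite /predict (bigD1 t)//=.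
rewrite ltr_pwDl ?mulr_gt0// sumr_ge0// => t' _.
by rewrite mulr_ge0// ltW.
Qed.

(** [L_bound] spreads positivity from one hypothesis to all, so an agent's observation is possible
    under every hypothesis or under none. *)
Lemma support_dichotomy xi :
  (forall th, Ljoint L xi th = 0) \/
  (forall k th, 0 < L k th (xi k) /\ `|ln (L k th (xi k))| <= C_L).
Proof.
have [supp|] := boolP [forall k, [exists th, 0 < L k th (xi k)]].
  right=> k th; apply: L_bound; move/forallP: supp => /(_ k)/existsP[t Lt].
  by exists t.
rewrite negb_forall => /existsP[k]; rewrite negb_exists => /forallP Lk.
left=> th; rewrite /Ljoint (bigD1 k)//=.
have /eqP -> : L k th (xi k) == 0 by have := Lk th; rewrite lt_def L_ge0 andbT negbK.
by rewrite mul0r.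
Qed.

(** The second clause is Bayes' rule: the unnormalized forward recursion is the density times the
    centralized posterior. *)
Definition regular_history s := [/\ 0 < dens s,
  forall th, alpha s th = dens s * mus s th,
  (forall th, 0 < mus s th) /\ \sum_th mus s th = 1 &
  forall k, (forall th, 0 < mu s k th) /\ \sum_th mu s k th = 1].

Lemma dens_rcons_null s xi : (forall th, alpha s th = 0) -> dens (rcons s xi) = 0.
Proof.
move=> a0; rewrite /obs_density foldl_rcons big1// => th _.
by rewrite /fwd /predict big1 ?mulr0// => t _; rewrite a0 mulr0.
Qed.

Lemma dens_rcons_out s xi : (forall th, Ljoint L xi th = 0) ->
  dens (rcons s xi) = 0.
Proof.
move=> L0; rewrite /obs_density foldl_rcons big1// => th _.
by rewrite /fwd L0 mul0r.
Qed.

Lemma dens_rcons_regular s xi : regular_history s -> dens (rcons s xi) =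
  dens s * \sum_th Ljoint L xi th * predict T (mus s) th.
Proof.
move=> [_ aE _ _]; rewrite /obs_density foldl_rcons mulr_sumr.
apply: eq_bigr => th _; rewrite /fwd mulrCA; congr (_ * _).
rewrite /predict mulr_sumr; apply: eq_bigr => t _.
by rewrite aE /obs_density; ring.
Qed.

Lemma regular_rcons s xi : regular_history s ->
  (forall k th, 0 < L k th (xi k) /\ `|ln (L k th (xi k))| <= C_L) ->
  regular_history (rcons s xi).
Proof.
move=> reg Lxi; have [d0 aE [ms0 ms1] m01] := reg.
have H0 : (0 < H)%N.
  rewrite lt0n; apply: contra_eq_neq ms1 => HE; rewrite big1 1?eq_sym ?oner_eq0//.
  by move=> th _; have := ltn_ord th; rewrite {2}HE.
have Lj0 th : 0 < Ljoint L xi th by apply: prodr_gt0 => k _; have [] := Lxi k th.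
have f0 th : 0 < Ljoint L xi th * predict T (mus s) th.
  by rewrite mulr_gt0// predict_gt0.
have S0 : 0 < \sum_th Ljoint L xi th * predict T (mus s) th.
  exact: (sum_gt0 (Ordinal H0)).
have msE : mus (rcons s xi) = cstep T L (mus s) xi by rewrite /mu_star foldl_rcons.
have mE : mu (rcons s xi) = dstep T L A gamma (mu s) xi by rewrite /dhs foldl_rcons.
split.
- by rewrite dens_rcons_regular// mulr_gt0.
- move=> th; rewrite dens_rcons_regular// msE /cstep /normalize -mulrA.
  rewrite [X in _ * X]mulrCA divff ?gt_eqF// mulr1 foldl_rcons /fwd mulrCA.
  congr (_ * _); rewrite /predict mulr_sumr; apply: eq_bigr => t _.
  by rewrite aE; ring.
- rewrite msE /cstep; split=> [th|]; first exact: normalize_gt0.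
  by rewrite normalize_sum1// gt_eqF.
- move=> k; rewrite mE /dstep; set f := fun th => \prod_(l < K | _) _.
  have g0 th : 0 < f th.
    apply: prodr_gt0 => l _; apply/powR_gt0/normalize_gt0 => t.
    rewrite mulr_gt0 ?predict_gt0 ?powR_gt0//; first by have [] := Lxi l t.
    by move=> t'; have [] := m01 l.
  split=> [th|]; first exact: normalize_gt0.
  by rewrite normalize_sum1// gt_eqF// (sum_gt0 (Ordinal H0)).
Qed.

(** A zero forward vector stays zero, and an observation outside the support creates one. Such
    histories have density zero and drop out of the expectations. *)
Lemma history_dichotomy s : (forall th, alpha s th = 0) \/ regular_history s.
Proof.
elim/last_ind: s => [|s xi [a0|reg]].
- right; split=> //; first by rewrite /obs_density /= mu0_star_sum.
  by move=> th; rewrite /obs_density /= mu0_star_sum mul1r.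
- left=> th; rewrite foldl_rcons /fwd /predict big1 ?mulr0// => t _.
  by rewrite a0 mulr0.
- have [L0|Lxi] := support_dichotomy xi; last by right; exact: regular_rcons.
  by left=> th; rewrite foldl_rcons /fwd L0 mul0r.
Qed.

Lemma dens_null s : (forall th, alpha s th = 0) -> dens s = 0.
Proof. by move=> a0; rewrite /obs_density big1. Qed.

(** Lyapunov family: the weights [w] and the constant [c] are general because one integration step
    changes both. *)
Definition weighted_div w c s := dens s * (\sum_k w k * KLd (mus s) (mu s k) + c).

Lemma weighted_div_ge0 w c s : (forall k, 0 <= w k) -> 0 <= c ->
  0 <= weighted_div w c s.
Proof.
move=> w0 c0; rewrite /weighted_div.
have [/dens_null->|[d0 _ [ms0 ms1] m01]] := history_dichotomy s.
  by rewrite mul0r.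
rewrite mulr_ge0 ?(ltW d0)// addr_ge0// sumr_ge0// => k _; rewrite mulr_ge0//.
have [m0 m1] := m01 k.
by rewrite KLd_ge0// ms1 m1.
Qed.

(** The factor of the joint likelihood in [KLd_step_le] for agent [k]. *)
Definition step_coef s k th :=
  predict T (mus s) th * (\sum_j A j k *
    ln (predict T (mus s) th / predict T (mu s j) th)) +
  2 * B * predict T (mus s) th + \sum_j A j k * predict T (mu s j) th
  - predict T (mus s) th.

Lemma weighted_div_rcons_le w c s xi : (forall k, 0 <= w k) ->
  weighted_div w c (rcons s xi) <= \sum_th dens s *
    (\sum_k w k * step_coef s k th + c * predict T (mus s) th) * Ljoint L xi th.
Proof.
move=> w0; rewrite /weighted_div.
have [a0|reg] := history_dichotomy s.
  rewrite dens_rcons_null// dens_null// mul0r big1// => th _.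
  by rewrite !mul0r.
have [L0|Lxi] := support_dichotomy xi.
  by rewrite dens_rcons_out// mul0r big1// => th _; rewrite L0 mulr0.
have [d0 _ [ms0 ms1] m01] := reg.
rewrite dens_rcons_regular//; set m := \sum_th _.
under [leRHS]eq_bigr do rewrite -mulrA.
rewrite -mulr_sumr -mulrA ler_wpM2l ?(ltW d0)//.
under [leRHS]eq_bigr do rewrite mulrDl mulr_suml.
rewrite big_split/= exchange_big/= mulrDr; apply: lerD; last first.
  by rewrite mulr_suml le_eqVlt; apply/orP; left; apply/eqP/eq_bigr => th _; ring.
rewrite mulr_sumr; apply: ler_sum => k _; rewrite mulrCA.
under [leRHS]eq_bigr do rewrite -mulrA.
rewrite -mulr_sumr ler_wpM2l//.
rewrite /mu_star /dhs !foldl_rcons -/(mus s) -/(mu s) /cstep /dstep.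
apply: (@KLd_step_le _ _ _ (fun j => A j k) gamma B C_L
  (fun j th => L j th (xi j)) (fun j => predict T (mu s j)) (predict T (mus s))) => //.
- by move=> j th; have [] := Lxi j th.
- by move=> j th; have [] := Lxi j th.
- by move=> j th; apply: predict_gt0; have [] := m01 j.
- by move=> th; exact: predict_gt0.
Qed.

(** Integration replaces each [Ljoint] by 1. The pooled and centralized predictions both have mass 1
    and cancel, [A] redistributes the weights, data processing contributes [kappa], and each unit of
    weight costs [2 * B]. *)
Lemma iter_int_weighted_div_le w c s : (forall k, 0 <= w k) -> 0 <= c ->
  (iter_int [seq nu k | k <- enum 'I_K]
     (fun b => (weighted_div w c (rcons s (jobs_of b)))%:E) <=
   (weighted_div (fun j => kappa * \sum_k w k * A j k)
      (c + 2 * B * \sum_k w k) s)%:E)%E.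
Proof.
move=> w0 c0; apply: (@le_trans _ _ (iter_int [seq nu k | k <- enum 'I_K]
  (fun b => (\sum_th dens s * (\sum_k w k * step_coef s k th +
    c * predict T (mus s) th) * Ljoint L (jobs_of b) th)%:E))).
  apply: le_iter_int => b _; rewrite lee_fin; first exact: weighted_div_ge0.
  exact: weighted_div_rcons_le.
rewrite iter_int_lin_lik// lee_fin /weighted_div -mulr_sumr.
have [a0|[d0 _ [ms0 ms1] m01]] := history_dichotomy s.
  by rewrite dens_null// !mul0r.
rewrite ler_wpM2l ?(ltW d0)// big_split/= -mulr_sumr predict_sum// ms1 mulr1.
rewrite addrA [leRHS]addrAC lerD2r exchange_big/=.
have coef k : \sum_th step_coef s k th =
    \sum_j A j k * KLd (predict T (mus s)) (predict T (mu s j)) + 2 * B.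
  rewrite /step_coef sumrB !big_split/= predict_sum// ms1 -mulr_sumr predict_sum//.
  rewrite ms1 [X in _ + X - _]exchange_big/=.
  have -> : \sum_j \sum_th A j k * predict T (mu s j) th = 1.
    rewrite -(A_sum k); apply: eq_bigr => j _.
    by rewrite -mulr_sumr predict_sum//; have [_ ->] := m01 j; rewrite mulr1.
  rewrite mulr1 addrK; congr (_ + _); under eq_bigr do rewrite mulr_sumr.
  rewrite exchange_big/=; apply: eq_bigr => j _; rewrite /KLd mulr_sumr.
  by apply: eq_bigr => th _; ring.
under eq_bigr do rewrite -mulr_sumr coef mulrDr.
rewrite big_split/= -mulr_suml [_ * (2 * B)]mulrC lerD2r.
under [leRHS]eq_bigr do rewrite -mulrA mulr_suml.
rewrite -mulr_sumr [X in _ * X]exchange_big/= mulr_sumr; apply: ler_sum => k _.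
rewrite mulr_sumr [leRHS]mulr_sumr; apply: ler_sum => j _.
rewrite mulrA [leRHS]mulrCA ler_wpM2l ?mulr_ge0//.
have [m0 m1] := m01 j.
by apply: KLd_predict_le => // th; apply: predict_gt0.
Qed.

(** Columns of [A] sum to one, so each step multiplies the total weight by [kappa]; the costs
    [2 * B] form a geometric sum. *)
Lemma nest_int_weighted_div_le n w c (M : R) : (forall k, 0 <= w k) -> 0 <= c ->
  kappa < 1 -> (forall k, KLd mu0_star (mu0 k) <= M) ->
  (nest_int nu n (fun s => (weighted_div w c s)%:E) <=
   ((\sum_k w k) * (kappa ^+ n * M + 2 * B * (1 - kappa ^+ n) / (1 - kappa))
     + c)%:E)%E.
Proof.
move=> + + k1 DM; elim: n w c => [|n IH] w c w0 c0.
  rewrite /= lee_fin /weighted_div {1}/obs_density /= mu0_star_sum mul1r lerD2r.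
  rewrite expr0 subrr mulr0 mul0r addr0 mul1r mulr_suml; apply: ler_sum => k _.
  exact: ler_wpM2l.
have kappa0 := dobrushin_ge0 T.
have w'0 j : 0 <= kappa * \sum_k w k * A j k.
  by rewrite mulr_ge0// sumr_ge0// => k _; rewrite mulr_ge0.
have W0 : 0 <= \sum_k w k by exact: sumr_ge0.
rewrite nest_int_rcons; apply: le_trans.
  apply: le_nest_int => s; last exact: iter_int_weighted_div_le.
  by apply: iter_int_ge0 => b _; rewrite lee_fin weighted_div_ge0.
apply: le_trans (IH _ _ w'0 _) _; first by rewrite addr_ge0 ?mulr_ge0.
rewrite lee_fin le_eqVlt; apply/orP; left; apply/eqP.
have -> : \sum_j kappa * \sum_k w k * A j k = kappa * \sum_k w k.
  rewrite -mulr_sumr exchange_big/=; congr (_ * _); apply: eq_bigr => k _.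
  by rewrite -mulr_sumr A_sum mulr1.
by rewrite exprS; field; rewrite subr_eq0 gt_eqF.
Qed.

Definition risk_bound M n := kappa ^+ n * M + 2 * B * (1 - kappa ^+ n) / (1 - kappa).

Let delta_w k (x : R) : 'I_K -> R := fun j => x *+ (j == k).

Lemma sum_delta_w k x (f : 'I_K -> R) : \sum_j delta_w k x j * f j = x * f k.
Proof.
rewrite (bigD1 k)//= /delta_w eqxx mulr1n big1 ?addr0// => j /negPf->.
by rewrite mulr0n mul0r.
Qed.

Lemma delta_w_ge0 k x j : 0 <= x -> 0 <= delta_w k x j.
Proof. by move=> x0; rewrite mulrn_wge0. Qed.

Lemma risk_J_le M k n : kappa < 1 -> (forall k, KLd mu0_star (mu0 k) <= M) ->
  (risk_J nu T L A gamma mu0 mu0_star k n <= (risk_bound M n)%:E)%E.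
Proof.
move=> k1 DM; have w0 j : 0 <= delta_w k 1 j by exact: delta_w_ge0.
have := @nest_int_weighted_div_le n (delta_w k 1) 0 M w0 (lexx _) k1 DM.
under eq_fun do rewrite /weighted_div addr0 sum_delta_w mul1r.
rewrite addr0; under eq_bigr do rewrite -[delta_w _ _ _]mulr1.
by rewrite sum_delta_w !mul1r.
Qed.

(** The prediction at time [n] uses [n.-1] observations, and data processing turns it into a
    posterior risk with initial weight [kappa]. *)
Lemma risk_Jt_le M k n : kappa < 1 -> (forall k, KLd mu0_star (mu0 k) <= M) ->
  (risk_Jt nu T L A gamma mu0 mu0_star k n <= (kappa * risk_bound M n.-1)%:E)%E.
Proof.
move=> k1 DM; have w0 j : 0 <= delta_w k kappa j.
  exact/delta_w_ge0/dobrushin_ge0.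
have := @nest_int_weighted_div_le n.-1 (delta_w k kappa) 0 M w0 (lexx _) k1 DM.
under [X in (_ <= ((X * _) + _)%:E)%E]eq_bigr do rewrite -[delta_w _ _ _]mulr1.
rewrite sum_delta_w addr0 mulr1; apply: le_trans.
apply: le_nest_int => s; rewrite lee_fin.
  have [/dens_null->|[d0 _ [ms0 ms1] m01]] := history_dichotomy s.
    by rewrite mul0r.
  have [m0 m1] := m01 k; rewrite mulr_ge0 ?(ltW d0)// KLd_ge0//.
  - by move=> th; exact: predict_gt0.
  - by move=> th; exact: predict_gt0.
  - by rewrite !predict_sum// ms1 m1.
rewrite /weighted_div addr0 sum_delta_w.
have [/dens_null->|[d0 _ [ms0 ms1] m01]] := history_dichotomy s.
  by rewrite !mul0r.
have [m0 m1] := m01 k; rewrite ler_wpM2l ?(ltW d0)//.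
by apply: KLd_predict_le => // th; exact: predict_gt0.
Qed.

Lemma risk_bound_cvg M : kappa < 1 ->
  (risk_bound M @ \oo --> 2 * B / (1 - kappa))%classic.
Proof.
move=> k1; have -> : risk_bound M = fun n =>
    2 * B / (1 - kappa) + kappa ^+ n * (M - 2 * B / (1 - kappa)).
  by apply/funext => n; rewrite /risk_bound; field; rewrite subr_eq0 gt_eqF.
have kn : (((fun n => kappa ^+ n) : nat -> R) @ \oo --> (0 : R))%classic.
  by apply: cvg_expr; rewrite ger0_norm// dobrushin_ge0.
have := cvgD (cvg_cst (2 * B / (1 - kappa)))
  (cvgMr_tmp (b := M - 2 * B / (1 - kappa)) kn).
rewrite mul0r addr0; exact.
Qed.
End Filter.

(** * Limits superior and the final bounds *)

Lemma limn_esup_le_cvg_bound (R : realType) (J : nat -> \bar R) (v : nat -> R) (l : R) :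
  (forall n, (J n <= (v n)%:E)%E) -> (v @ \oo --> l)%classic ->
  (limn_esup J <= l%:E)%E.
Proof.
move=> Jv vl.
have vlE : ((EFin \o v) @ \oo --> l%:E)%classic by apply: cvg_EFin => //; exact: nearW.
rewrite -(cvg_limn_einf_sup vlE).2 !limn_esup_lim.
apply: lee_lim; [exact: is_cvg_esups|exact: is_cvg_esups|].
apply: nearW => n; apply: ge_ereal_sup => _ [p /= np <-].
apply: le_trans (Jv p) _; apply: ereal_sup_ubound.
by exists p.
Qed.

Theorem theorem1 (R : realType) (d : measure_display) (X : measurableType d)
    (H K : nat)
    (* Markov chain of the true state *)
    (T : 'I_H -> 'I_H -> R) (mu0_star : 'I_H -> R)
    (* reference measures and likelihoods: L k th x = L_k(x | th) *)
    (nu : 'I_K -> {measure set X -> \bar R}) (L : 'I_K -> 'I_H -> X -> R)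
    (C_L : R)
    (* network *)
    (A : 'M[R]_K)
    (* DHS *)
    (gamma : R) (mu0 : 'I_K -> 'I_H -> R)
    (rho2 : R) :
    (forall th th', 0 <= T th th') ->
    (forall th', \sum_(th < H) T th th' = 1) ->
    (forall th, 0 < mu0_star th) -> \sum_(th < H) mu0_star th = 1 ->
    (forall k, sigma_finite setT (nu k)) ->
    (forall k th, measurable_fun setT (L k th)) ->
    (forall k th x, 0 <= L k th x) ->
    (forall k th, (\int[nu k]_x (L k th x)%:E = 1)%E) ->
    (forall k th th', (KL_lik nu L k th th' < +oo)%E) ->
    (forall k th x, (exists th', 0 < L k th' x) ->
        0 < L k th x /\ `|ln (L k th x)| <= C_L) ->
    strongly_connected A ->
    (exists k, 0 < A k k) ->
    (forall l k, 0 <= A l k) ->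
    (forall k, \sum_(l < K) A k l = 1) ->
    A = A^T ->
    0 < gamma ->
    (forall k th, 0 < mu0 k th) ->
    (forall k, \sum_(th < H) mu0 k th = 1) ->
    dobrushin T < 1 ->
    irreducible_chain T ->
    aperiodic_chain T ->
    second_modulus_eigenvalue A rho2 ->
    let lambda := Num.max `|1 - K%:R / gamma| rho2 in
    forall k : 'I_K,
      (limn_esup (fun i => risk_J nu T L A gamma mu0 mu0_star k i)
         <= (2 * Num.sqrt K%:R * gamma * lambda * C_L / (1 - dobrushin T))%:E)%E
   /\ (limn_esup (fun i => risk_Jt nu T L A gamma mu0 mu0_star k i)
         <= (2 * dobrushin T * Num.sqrt K%:R * gamma * lambda * C_L
             / (1 - dobrushin T))%:E)%E.
Proof.
move=> T_ge0 T_sum ms_gt0 ms_sum _ L_meas L_ge0 L_int1 _ L_bound _ _ A_ge0 A_sum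
  A_sym gamma_gt0 mu0_gt0 mu0_sum kappa_lt1 T_irr _ [s [As s_sorted ->]] lambda k.
(* A positive return probability requires a transition into [th]; this keeps predicted beliefs
   positive. *)
have T_row th : exists th', 0 < T th th'.
  have [[//|n] _ /=] := T_irr th th.
  have [/existsP[t Tt] _|] := boolP [exists t, 0 < T th t]; first by exists t.
  rewrite negb_exists => /forallP T0; rewrite big1 ?ltxx// => t _.
  have /eqP-> : T th t == 0 by have := T0 t; rewrite lt_def T_ge0 andbT negbK.
  by rewrite mul0r.
have A_sumT l : \sum_j A j l = 1.
  by rewrite -[RHS](A_sum l); apply: eq_bigr => j _; rewrite {1}A_sym mxE.
have H_gt0 : (0 < H)%N.
  rewrite lt0n; apply: contra_eq_neq ms_sum => HE; rewrite big1 1?eq_sym ?oner_eq0//.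
  by move=> th _; have := ltn_ord th; rewrite [X in (_ < X)%N]HE.
(* A density of integral one is positive somewhere, and there [C_L] dominates an absolute value. *)
have C_ge0 : 0 <= C_L.
  pose th0 := Ordinal H_gt0.
  have [x Lx] : exists x, 0 < L k th0 x.
    apply: contrapT => /forallNP L0; have := L_int1 k th0.
    under eq_integral => x _.
      have -> : L k th0 x = 0.
        by apply/eqP; have /negP := L0 x; rewrite lt_def L_ge0 andbT negbK.
      over.
    by rewrite integral0 => /eqP; rewrite eq_sym onee_eq0.
  have [_] := L_bound k th0 x (ex_intro _ th0 Lx).
  exact: le_trans.
pose B := Num.sqrt K%:R * gamma * lambda * C_L.
have lambda_ge0 : 0 <= lambda by rewrite le_max normr_ge0.
have B_ge0 : 0 <= B by rewrite !mulr_ge0 ?sqrtr_ge0// ltW.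
have A_dev j : (\sum_l `|1 - gamma * A l j|) * C_L <= B.
  by rewrite ler_wpM2r//; exact: sum_dev_col_le.
(* A common bound on the initial divergences, whose factor [kappa ^+ n] vanishes in the limit. *)
pose M := \sum_j `|KLd mu0_star (mu0 j)|.
have DM j : KLd mu0_star (mu0 j) <= M.
  apply: le_trans (ler_norm _) _.
  by rewrite /M (bigD1 j)//= lerDl sumr_ge0.
have bound_cvg := @risk_bound_cvg R H T B M kappa_lt1.
have -> : 2 * Num.sqrt K%:R * gamma * lambda * C_L / (1 - dobrushin T) =
    2 * B / (1 - dobrushin T) by rewrite /B !mulrA.
have -> : 2 * dobrushin T * Num.sqrt K%:R * gamma * lambda * C_L /
    (1 - dobrushin T) = dobrushin T * (2 * B / (1 - dobrushin T)).
  by rewrite /B; ring.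
split.
  apply: limn_esup_le_cvg_bound bound_cvg => n.
  exact: (@risk_J_le _ _ _ _ _ _ _ _ _ C_L).
apply: (@limn_esup_le_cvg_bound _ _
    (fun n => dobrushin T * risk_bound T B M n.-1)) => [n|].
  exact: (@risk_Jt_le _ _ _ _ _ _ _ _ _ C_L).
(* Shifting the index turns [n.-1] into [n]. *)
rewrite -cvg_shiftS; exact: cvgMl_tmp bound_cvg.
Qed.
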